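(* Let $\Xi\subset\mathbb{R}^N$ be a compact convex set with non-empty interior. The affinely adjustable robust counterpart (AARC) is a special case of the multipolar robust counterpart (MRC), obtained with the identity shadow matrix and any pole-set made of $\dim(\Xi)+1$ affinely independent poles. That is: if $\Omega\subset\mathbb{R}^N$ is a set of $\dim(\Xi)+1$ affinely independent points with $\Xi\subseteq\operatorname{conv}\Omega$, then a pair $(u,v(\cdot))$ with $u\in\mathbb{R}^n$, $v:\Xi\to\mathbb{R}^q$ is feasible for MRC with pole-set $\Omega$ if and only if it is feasible for AARC; in particular the two problems have the same optimal value.
   Context: Setting: $m,n,q\ge 1$ are integers, $V\in\mathbb{R}^{m\times q}$ and $c\in\mathbb{R}^n$ are fixed. An uncertain parameter is $\xi\equiv[U_\xi,b_\xi]$ with $U_\xi\in\mathbb{R}^{m\times n}$, $b_\xi\in\mathbb{R}^m$, identified with a vector of $\mathbb{R}^N$, $N=m(n+1)$ (so $\dim\Xi=N$). Vector inequalities are componentwise. AARC: minimize $c^Tu$ over $u\in\mathbb{R}^n$, $w\in\mathbb{R}^q$, $W\in\mathbb{R}^{q\times N}$ subject to $U_\xi u+V(w+W\xi)\le b_\xi$ for all $\xi\in\Xi$. A pair $(u,v(\cdot))$ is feasible for AARC if $v(\xi)=w+W\xi$ on $\Xi$ for some feasible $(u,w,W)$. MRC (identity shadow matrix) with a finite pole-set $\Omega$, $\Xi\subseteq\operatorname{conv}\Omega$: for $\xi\in\Xi$ let $\Lambda_\xi=\{\lambda\in\mathbb{R}^\Omega_{\ge 0}:\sum_\omega\lambda_\omega\omega=\xi,\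 \sum_\omega\lambda_\omega=1\}$; minimize $c^Tu$ over $u\in\mathbb{R}^n$ and $v_\omega\in\mathbb{R}^q$ ($\omega\in\Omega$) subject to $U_\xi u+V\sum_{\omega\in\Omega}\lambda_\omega v_\omega\le b_\xi$ for all $\xi\in\Xi$, $\lambda\in\Lambda_\xi$. A pair $(u,v(\cdot))$ is feasible for MRC if there is a feasible $(u,(v_\omega)_\omega)$ with $v(\xi)=\sum_\omega\lambda_\omega v_\omega$ for all $\xi\in\Xi$ and all $\lambda\in\Lambda_\xi$. Optimal values are infima in $[-\infty,+\infty]$. *)

(* Defs.v *)
From HB Require Import structures.
From mathcomp Require Import all_boot all_order all_algebra finmap.
From mathcomp Require Import all_classical all_reals all_analysis.

Import Order.TTheory GRing.Theory Num.Theory.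
Import numFieldNormedType.Exports.

Local Open Scope classical_set_scope.
Local Open Scope ring_scope.

Definition vle {R : realType} {k : nat} (x y : 'cV[R]_k) : Prop :=
  forall i, x i 0 <= y i 0.

(* A parameter [U, b], an m x (n + 1) matrix, is identified with the column
   vector of its entries listed row by row; U_of and b_of undo this. *)
Definition U_of {R : realType} {m n : nat} (xi : 'cV[R]_(m * (n + 1))) :
  'M[R]_(m, n) := lsubmx (vec_mx xi^T).

Definition b_of {R : realType} {m n : nat} (xi : 'cV[R]_(m * (n + 1))) :
  'cV[R]_m := rsubmx (vec_mx xi^T).

Definition affinely_independent {R : realType} {N : nat}
    (Omega : {fset 'cV[R]_N}) : Prop :=
  forall a : Omega -> R,
    \sum_(w : Omega) a w *: val w = 0 -> \sum_(w : Omega) a w = 0 ->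
    forall w, a w = 0.

(* The largest k such that S contains k + 1 affinely independent points (0 if S
   is empty).  Bounding k by N loses nothing: N + 2 points of R^N are never
   affinely independent. *)
Definition affine_dim {R : realType} {N : nat} (S : set 'cV[R]_N) : nat :=
  (\max_(k < N.+1 | `[< exists P : {fset 'cV[R]_N},
      [/\ [set` P] `<=` S, affinely_independent P & #|` P| = k.+1] >]) k)%N.

Definition Lambda {R : realType} {N : nat} (Omega : {fset 'cV[R]_N})
    (xi : 'cV[R]_N) : set (Omega -> R) :=
  [set lambda | [/\ forall w, 0 <= lambda w,
                    \sum_(w : Omega) lambda w *: val w = xi
                  & \sum_(w : Omega) lambda w = 1]].

Definition conv_hull {R : realType} {N : nat} (Omega : {fset 'cV[R]_N}) :
  set 'cV[R]_N := [set xi | Lambda Omega xi !=set0].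

Definition AARC_feasible {R : realType} {m n q : nat} (V : 'M[R]_(m, q))
    (Xi : set 'cV[R]_(m * (n + 1)))
    (u : 'cV[R]_n) (w : 'cV[R]_q) (W : 'M[R]_(q, m * (n + 1))) : Prop :=
  forall xi, Xi xi -> vle (U_of xi *m u + V *m (w + W *m xi)) (b_of xi).

Definition AARC_feasible_pair {R : realType} {m n q : nat} (V : 'M[R]_(m, q))
    (Xi : set 'cV[R]_(m * (n + 1)))
    (u : 'cV[R]_n) (v : Xi -> 'cV[R]_q) : Prop :=
  exists (w : 'cV[R]_q) (W : 'M[R]_(q, m * (n + 1))),
    AARC_feasible V Xi u w W /\ forall xi : Xi, v xi = w + W *m val xi.

Definition AARC_value {R : realType} {m n q : nat} (V : 'M[R]_(m, q))
    (c : 'cV[R]_n) (Xi : set 'cV[R]_(m * (n + 1))) : \bar R :=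
  ereal_inf [set ((c^T *m u) 0 0)%:E | u in
    [set u | exists w W, AARC_feasible V Xi u w W]].

Definition MRC_feasible {R : realType} {m n q : nat} (V : 'M[R]_(m, q))
    (Xi : set 'cV[R]_(m * (n + 1))) (Omega : {fset 'cV[R]_(m * (n + 1))})
    (u : 'cV[R]_n) (vpole : Omega -> 'cV[R]_q) : Prop :=
  forall xi, Xi xi -> forall lambda, Lambda Omega xi lambda ->
    vle (U_of xi *m u + V *m (\sum_(w : Omega) lambda w *: vpole w)) (b_of xi).

Definition MRC_feasible_pair {R : realType} {m n q : nat} (V : 'M[R]_(m, q))
    (Xi : set 'cV[R]_(m * (n + 1))) (Omega : {fset 'cV[R]_(m * (n + 1))})
    (u : 'cV[R]_n) (v : Xi -> 'cV[R]_q) : Prop :=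
  exists vpole : Omega -> 'cV[R]_q,
    MRC_feasible V Xi Omega u vpole /\
    forall (xi : Xi) lambda, Lambda Omega (val xi) lambda ->
      v xi = \sum_(w : Omega) lambda w *: vpole w.

Definition MRC_value {R : realType} {m n q : nat} (V : 'M[R]_(m, q))
    (c : 'cV[R]_n) (Xi : set 'cV[R]_(m * (n + 1)))
    (Omega : {fset 'cV[R]_(m * (n + 1))}) : \bar R :=
  ereal_inf [set ((c^T *m u) 0 0)%:E | u in
    [set u | exists vpole : Omega -> 'cV[R]_q, MRC_feasible V Xi Omega u vpole]].

(* Main.v *)
(** Any values prescribed at affinely independent poles are interpolated by an
affine map [xi |-> w + W xi], and an affine map commutes with convex
combinations.  Pole values [v_omega] and decision rules [(w, W)] therefore
correspond through [v_omega = w + W omega], and feasibility is the same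
condition on both sides. *)

Require Import Defs.
From HB Require Import structures.
From mathcomp Require Import all_boot all_order all_algebra finmap.
From mathcomp Require Import all_classical all_reals all_analysis.

Import Order.TTheory GRing.Theory Num.Theory.
Import numFieldNormedType.Exports.

Local Open Scope classical_set_scope.
Local Open Scope ring_scope.

(** Affine independence of the poles is linear independence of the rows [(1, p^T)], so the linear
    system for the coefficients [(w, W)] is solvable for every right-hand side. *)
Lemma affine_interpolation {R : realType} {N q : nat}
    {Omega : {fset 'cV[R]_N}} (f : Omega -> 'cV[R]_q) :
  affinely_independent Omega ->
  exists (w : 'cV[R]_q) (W : 'M[R]_(q, N)),
    forall p : Omega, f p = w + W *m val p.
Proof.
move=> indep.
pose A : 'M[R]_(#|{: Omega}|, 1 + N) :=
  \matrix_i row_mx 1%:M (val (enum_val i))^T.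
(* In a vanishing combination of rows of [A], the last [N] columns give a zero combination of the
   poles and the leading column of ones gives a zero coefficient sum. *)
have /row_freeP[B AB1] : row_free A.
  apply: inj_row_free => a aA0.
  have: \sum_(p : Omega) a 0 (enum_rank p) *: row_mx 1%:M (val p)^T = a *m A.
    rewrite mulmx_sum_row (reindex (@enum_val _ Omega)) /=; last first.
      exact: onW_bij (enum_val_bij _).
    by apply: eq_bigr => i _; rewrite rowK enum_valK.
  rewrite aA0 => sum0.
  have a_val0 : \sum_(p : Omega) a 0 (enum_rank p) *: val p = 0.
    apply: trmx_inj; rewrite trmx0.
    have := congr1 rsubmx sum0; rewrite [RHS]linear0; apply: etrans.
    rewrite !linear_sum; apply: eq_bigr => p _.
    by rewrite !linearZ /= row_mxKr.
  have a_sum0 : \sum_(p : Omega) a 0 (enum_rank p) = 0.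
    have /matrixP/(_ 0 0) := congr1 lsubmx sum0.
    rewrite [in RHS]linear0 [RHS]mxE; apply: etrans.
    rewrite linear_sum summxE; apply: eq_bigr => p _.
    by rewrite linearZ /= row_mxKl !mxE eqxx mulr1.
  apply/rowP => i; rewrite mxE -[i]enum_valK.
  exact: (indep (fun p => a 0 (enum_rank p))).
(* As [B] is a right inverse of [A], this [C] solves [A *m C] = matrix of values. Its top row meets
   the column of ones and yields [w]; the remaining rows yield [W]. *)
pose C : 'M[R]_(1 + N, q) := B *m \matrix_i (f (enum_val i))^T.
exists (usubmx C)^T, (dsubmx C)^T => p.
have : row (enum_rank p) (A *m C) = (f p)^T.
  by rewrite mulmxA AB1 mul1mx rowK enum_rankK.
rewrite row_mul rowK enum_rankK -[C in LHS]vsubmxK mul_row_col mul1mx.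
by move/(congr1 trmx); rewrite trmxK linearD /= trmx_mul trmxK => ->.
Qed.

(** The constant [w] survives because the weights sum to 1. *)
Lemma Lambda_affine {R : realType} {N q : nat} {Omega : {fset 'cV[R]_N}}
    {xi : 'cV[R]_N} {lambda : Omega -> R} (w : 'cV[R]_q) (W : 'M[R]_(q, N)) :
  Lambda Omega xi lambda ->
  \sum_(p : Omega) lambda p *: (w + W *m val p) = w + W *m xi.
Proof.
move=> [_ <- sum1]; rewrite mulmx_sumr.
under eq_bigr do rewrite scalerDr.
rewrite big_split /= -scaler_suml sum1 scale1r; congr (_ + _).
by apply: eq_bigr => p _; rewrite scalemxAr.
Qed.

(** For affine pole values the constraint at [xi] is the same for every [lambda]. The inclusion in
    the hull supplies at least one [lambda], so the MRC constraint is never vacuous. *)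
Lemma MRC_feasible_affine {R : realType} {m n q : nat} (V : 'M[R]_(m, q))
    (Xi : set 'cV[R]_(m * (n + 1))) (Omega : {fset 'cV[R]_(m * (n + 1))})
    (u : 'cV[R]_n) (w : 'cV[R]_q) (W : 'M[R]_(q, m * (n + 1))) :
  Xi `<=` conv_hull Omega ->
  MRC_feasible V Xi Omega u (fun p => w + W *m val p) <->
  AARC_feasible V Xi u w W.
Proof.
move=> Xi_sub; split=> [feas xi Xi_xi | feas xi Xi_xi lambda lambda_xi].
  have [lambda lambda_xi] := Xi_sub _ Xi_xi.
  by have := feas _ Xi_xi _ lambda_xi; rewrite (Lambda_affine _ _ lambda_xi).
by rewrite (Lambda_affine _ _ lambda_xi); exact: feas.
Qed.

Theorem corollary1 (R : realType) (m n q : nat)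
    (m_ge1 : (1 <= m)%N) (n_ge1 : (1 <= n)%N) (q_ge1 : (1 <= q)%N)
    (V : 'M[R]_(m, q)) (c : 'cV[R]_n)
    (Xi : set 'cV[R]_(m * (n + 1)))
    (Xi_compact : compact Xi) (Xi_convex : convex_set Xi)
    (Xi_interior : interior Xi !=set0)
    (Omega : {fset 'cV[R]_(m * (n + 1))})
    (Omega_card : #|` Omega| = (affine_dim Xi + 1)%N)
    (Omega_indep : affinely_independent Omega)
    (Xi_sub : Xi `<=` conv_hull Omega) :
  (forall (u : 'cV[R]_n) (v : Xi -> 'cV[R]_q),
     MRC_feasible_pair V Xi Omega u v <-> AARC_feasible_pair V Xi u v) /\
  MRC_value V c Xi Omega = AARC_value V c Xi.
Proof.
have interp (vpole : Omega -> 'cV[R]_q) :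
    exists w W, vpole = fun p => w + W *m val p.
  have [w [W vpoleE]] := affine_interpolation vpole Omega_indep.
  by exists w, W; apply/funext.
split=> [u v|].
  split=> [[vpole []]|[w [W [feas vE]]]].
    have [w [W ->]] := interp vpole.
    move=> /(MRC_feasible_affine _ _ _ _ _ _ Xi_sub) feas vE.
    exists w, W; split=> // xi.
    (* [vE] determines [v xi] only through weights, so some representation of [xi] is chosen. *)
    have [lambda lambda_xi] := Xi_sub _ (set_mem (valP xi)).
    by rewrite (vE _ _ lambda_xi) (Lambda_affine _ _ lambda_xi).
  exists (fun p => w + W *m val p); split=> [|xi lambda lambda_xi].
    exact/MRC_feasible_affine.
  by rewrite vE (Lambda_affine _ _ lambda_xi).
(* The objective depends on [u] alone, so it suffices that both problems admit the same [u]. *)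
rewrite /MRC_value /AARC_value; congr (ereal_inf (image _ _)).
apply/seteqP; split=> u /=.
  move=> [vpole]; have [w [W ->]] := interp vpole.
  by move=> /(MRC_feasible_affine _ _ _ _ _ _ Xi_sub) feas; exists w, W.
move=> [w [W feas]]; exists (fun p => w + W *m val p).
exact/MRC_feasible_affine.
Qed.
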